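(* Let $(\mathbf{A},p,\phi)$ and $(\mathbf{B},q,\theta)$ be categorical probabilistic triples. Then $$\mathcal{H}\big((\mathbf{A},p,\phi)\otimes(\mathbf{B},q,\theta)\big)=\mathcal{H}(\mathbf{A},p,\phi)+\mathcal{H}(\mathbf{B},q,\theta).$$
   Context: A categorical probabilistic triple $(\mathbf{A},p,\phi)$ consists of (1) a finite category $\mathbf{A}$; (2) a probability $p$ on the finite set $\operatorname{Ob}(\mathbf{A})$; (3) a function $\phi:\operatorname{Ob}(\mathbf{A})\times\operatorname{Ob}(\mathbf{A})\to[0,\infty)$ such that $\phi(a,a)>0$ for all objects $a$, and $\phi(b,b')=0$ whenever there is no arrow from $b$ to $b'$ in $\mathbf{A}$. The categorical entropy of a triple is $$\mathcal{H}(\mathbf{A},p,\phi):=-\sum_{a\in\operatorname{Ob}(\mathbf{A})}p(a)\ln\Big(\sum_{b\in\operatorname{Ob}(\mathbf{A})}p(b)\phi(a,b)\Big),$$ with the convention that the summand indexed by $a$ is $0$ whenever $p(a)=0$. The probability preserving product $(\mathbf{A},p,\phi)\otimes(\mathbf{B},q,\theta)$ is the triple $(\mathbf{A}\times\mathbf{B},\,p\otimes q,\,\phi\otimes\theta)$, where $\mathbf{A}\times\mathbf{B}$ is the product category and, for all $\langle a,b\rangle,\langle a',b'\rangle\in\operatorname{Ob}(\mathbf{A}\times\mathbf{B})$, $$(p\otimes q)(\langle a,b\rangle)=p(a)q(b),\qquad(\phi\otimes\theta)(\langle a,b\rangle,\langle a',b'\rangle)=\phi(a,a')\,\theta(b,b').$$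 *)

(* Defs.v *)
From HB Require Import structures.
From mathcomp Require Import all_boot all_order all_algebra.
From mathcomp Require Import all_classical all_reals all_analysis.

Set Implicit Arguments.
Unset Strict Implicit.
Unset Printing Implicit Defensive.

Import Order.TTheory GRing.Theory Num.Theory.

Local Open Scope ring_scope.

(* [compm f g] is the composite in diagrammatic order, f first and then g. *)
Record finCategory := FinCategory {
  Ob : finType;
  Hom : Ob -> Ob -> finType;
  idm : forall a, Hom a a;
  compm : forall a b c, Hom a b -> Hom b c -> Hom a c;
  comp1m : forall a b (f : Hom a b), compm (idm a) f = f;
  compm1 : forall a b (f : Hom a b), compm f (idm b) = f;
  compmA : forall a b c d (f : Hom a b) (g : Hom b c) (h : Hom c d),
    compm f (compm g h) = compm (compm f g) h
}.

Section ProductCategory.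
Variables A B : finCategory.

Definition prod_Ob : finType := (Ob A * Ob B)%type.

Definition prod_Hom (x y : prod_Ob) : finType :=
  (Hom x.1 y.1 * Hom x.2 y.2)%type.

Definition prod_idm (x : prod_Ob) : prod_Hom x x := (idm x.1, idm x.2).

Definition prod_comp (x y z : prod_Ob) (f : prod_Hom x y) (g : prod_Hom y z) :
  prod_Hom x z := (compm f.1 g.1, compm f.2 g.2).

Lemma prod_comp1m (x y : prod_Ob) (f : prod_Hom x y) :
  prod_comp (prod_idm x) f = f.
Proof. by case: f => f g; rewrite /prod_comp /= !comp1m. Qed.

Lemma prod_compm1 (x y : prod_Ob) (f : prod_Hom x y) :
  prod_comp f (prod_idm y) = f.
Proof. by case: f => f g; rewrite /prod_comp /= !compm1. Qed.

Lemma prod_compA (x y z t : prod_Ob)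
    (f : prod_Hom x y) (g : prod_Hom y z) (h : prod_Hom z t) :
  prod_comp f (prod_comp g h) = prod_comp (prod_comp f g) h.
Proof. by rewrite /prod_comp /= !compmA. Qed.

Definition prod_category : finCategory :=
  FinCategory prod_comp1m prod_compm1 prod_compA.

End ProductCategory.

Record catTriple (R : realType) := CatTriple {
  base_cat : finCategory;
  prob : Ob base_cat -> R;
  prob_ge0 : forall a, 0 <= prob a;
  prob_sum1 : \sum_a prob a = 1;
  phi : Ob base_cat -> Ob base_cat -> R;
  phi_ge0 : forall a b, 0 <= phi a b;
  phi_diag_gt0 : forall a, 0 < phi a a;
  phi_eq0 : forall a b, #|Hom a b| = 0%N -> phi a b = 0
}.

Section Tensor.
Variables (R : realType) (X Y : catTriple R).

Let C := prod_category (base_cat X) (base_cat Y).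

Definition tensor_prob (x : Ob C) : R := prob x.1 * prob x.2.

Definition tensor_phi (x y : Ob C) : R := phi x.1 y.1 * phi x.2 y.2.

Lemma tensor_prob_ge0 (x : Ob C) : 0 <= tensor_prob x.
Proof. by apply: mulr_ge0; apply: prob_ge0. Qed.

Lemma tensor_prob_sum1 : \sum_x tensor_prob x = 1.
Proof.
rewrite -(pair_bigA _ (fun a b => prob a * prob b)) /=.
under eq_bigr => a _ do rewrite -mulr_sumr prob_sum1 mulr1.
exact: prob_sum1.
Qed.

Lemma tensor_phi_ge0 (x y : Ob C) : 0 <= tensor_phi x y.
Proof. by apply: mulr_ge0; apply: phi_ge0. Qed.

Lemma tensor_phi_diag_gt0 (x : Ob C) : 0 < tensor_phi x x.
Proof. by apply: mulr_gt0; apply: phi_diag_gt0. Qed.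

Lemma tensor_phi_eq0 (x y : Ob C) : #|Hom x y| = 0%N -> tensor_phi x y = 0.
Proof.
rewrite card_prod => /eqP; rewrite muln_eq0 /tensor_phi.
by case/orP => /eqP /phi_eq0 ->; rewrite ?mul0r ?mulr0.
Qed.

Definition tensor : catTriple R :=
  CatTriple tensor_prob_ge0 tensor_prob_sum1
    tensor_phi_ge0 tensor_phi_diag_gt0 tensor_phi_eq0.

End Tensor.

(* The restriction to [prob a != 0] is the convention that null objects
   contribute 0. *)
Definition entropy (R : realType) (X : catTriple R) : R :=
  - \sum_(a : Ob (base_cat X) | prob a != 0)
      prob a * ln (\sum_(b : Ob (base_cat X)) prob b * phi a b).

(* Main.v *)
Require Import Defs.
From mathcomp Require Import all_boot all_order all_algebra.
From mathcomp Require Import all_classical all_reals all_analysis.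

(** Write [Z a] for the mean similarity [\sum_b prob b * phi a b], so that the
    entropy is the expectation of [- ln (Z a)].  Since both the probability and
    [phi] of a product are products of functions of one coordinate each, [Z] is
    multiplicative ([mean_phi_tensor]).  At objects of nonzero probability [Z]
    is positive, because its diagonal term is ([mean_phi_gt0]); the logarithm
    therefore turns the product into a sum there.  Taking the expectation, each
    of the two terms depends on one coordinate only, and the other coordinate
    integrates to [1]. *)

Import Order.TTheory GRing.Theory Num.Theory.

Local Open Scope ring_scope.

Definition mean_phi {R : realType} (X : catTriple R) (a : Ob (base_cat X)) : R :=
  \sum_b prob b * phi a b.

Lemma mean_phi_gt0 (R : realType) (X : catTriple R) (a : Ob (base_cat X)) :
  prob a != 0 -> 0 < mean_phi X a.
Proof.
move=> pa0; rewrite /mean_phi (bigD1 a) //= ltr_wpDr //.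
  by apply: sumr_ge0 => b _; rewrite mulr_ge0 ?prob_ge0 ?phi_ge0.
by rewrite mulr_gt0 ?phi_diag_gt0 // lt0r pa0 prob_ge0.
Qed.

Lemma mean_phi_tensor (R : realType) (X Y : catTriple R)
    (a : Ob (base_cat X)) (b : Ob (base_cat Y)) :
  mean_phi (tensor X Y) (a, b) = mean_phi X a * mean_phi Y b.
Proof.
rewrite /mean_phi big_distrlr pair_bigA /=.
by apply: eq_bigr => x _; rewrite /tensor_prob /tensor_phi /= mulrACA.
Qed.

(** A null object contributes [0] whatever value [ln] takes there.  Summing over
    all objects is what lets a sum over pairs split into an iterated sum. *)
Lemma entropyE (R : realType) (X : catTriple R) :
  entropy X = - \sum_a prob a * ln (mean_phi X a).
Proof.
rewrite /entropy; congr (- _); rewrite big_mkcond; apply: eq_bigr => a _.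
by case: eqP => //= ->; rewrite mul0r.
Qed.

(** Where both probabilities are nonzero, [ln] is additive on the product of the
    positive factors; elsewhere a vanishing probability kills every term. *)
Lemma tensor_entropy_summand (R : realType) (X Y : catTriple R)
    (a : Ob (base_cat X)) (b : Ob (base_cat Y)) :
  prob a * prob b * ln (mean_phi X a * mean_phi Y b) =
  prob a * ln (mean_phi X a) * prob b + prob a * (prob b * ln (mean_phi Y b)).
Proof.
have [->|pa0] := eqVneq (prob a) 0; first by rewrite !mul0r addr0.
have [->|pb0] := eqVneq (prob b) 0; first by rewrite !(mulr0, mul0r) addr0.
rewrite lnM ?posrE ?mean_phi_gt0 //.
by rewrite mulrDr [in X in X + _]mulrAC -[in X in _ + X]mulrA.
Qed.

Theorem proposition2 (R : realType) (X Y : catTriple R) :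
  entropy (tensor X Y) = entropy X + entropy Y.
Proof.
rewrite !entropyE -opprD; congr (- _).
transitivity (\sum_a \sum_b
    (prob a * ln (mean_phi X a) * prob b +
     prob a * (prob b * ln (mean_phi Y b)))).
  rewrite pair_bigA; apply: eq_bigr => -[a b] _.
  by rewrite mean_phi_tensor -tensor_entropy_summand.
under eq_bigr => a _ do rewrite big_split -!mulr_sumr prob_sum1 mulr1.
by rewrite big_split /= -mulr_suml prob_sum1 mul1r.
Qed.
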